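(* Let $n \ge 1$ and let $\langle u,v\rangle$ and $\langle u',v'\rangle$ be semigroup identities over $\{a,b\}$ satisfied by the monoid $\mathcal M_n(\mathbb T)$ of $n\times n$ tropical matrices. Then the monoid $\mathcal M_n(\mathbb{ST})$ of $n\times n$ supertropical matrices satisfies the semigroup identity $$\big\langle\, u[u',v'],\; v[u',v'] \,\big\rangle .$$
   Context: **Tropical semiring.** $\mathbb T=\mathbb R\cup\{-\infty\}$ with addition $\max$ and multiplication the usual sum. **Supertropical semiring.** $\mathbb{ST}=\mathbb R\cup\{-\infty\}\cup\mathbb R^\nu$ is the disjoint union of two copies of $\mathbb R$ together with the zero element $-\infty$; elements of $\mathbb R^\nu$ are written $a^\nu$, $a\in\mathbb R$. The map $\nu:\mathbb{ST}\to\mathbb R^\nu\cup\{-\infty\}$ is given by $\nu(a)=\nu(a^\nu)=a^\nu$ for $a\in\mathbb R$ and $\nu(-\infty)=-\infty$. The total order is $-\infty<a<a^\nu<b<b^\nu$ for all real $a<b$. Addition: $x\vee y=\max\{x,y\}$ if $\nu(x)\neq\nu(y)$, and $x\vee y=\nu(x)$ if $\nu(x)=\nu(y)$. Multiplication: $x\cdot y$ is the usual sum $x+y$ if $x,y\in\mathbb R$; otherwise it is the sum of $\nu(x)$ and $\nu(y)$, where $a^\nu+b^\nu=(a+b)^\nu$ and $-\infty$ is absorbing. The multiplicative identity is $0\in\mathbb R$. **Matrices.** For a semiring $R$, $\mathcal M_n(R)$ is the multiplicative monoid of $n\times n$ matrices over $R$. **Identities.** $\{a,b\}^+$ is the free semigroup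 of nonempty words in $a,b$. For a word $w$ and elements $s,t$ of a semigroup $\mathcal S$, $w[\![s,t]\!]$ is the evaluation of $w$ under $a\mapsto s$, $b\mapsto t$; when $\mathcal S=\{a,b\}^+$ and $s,t$ are words, this evaluation is again a word and is denoted $w[s,t]$. A (nontrivial) semigroup identity is a pair $\langle u,v\rangle$ of words $u\ne v$ in $\{a,b\}^+$; $\mathcal S$ satisfies (admits) it if $u[\![s,t]\!]=v[\![s,t]\!]$ for all $s,t\in\mathcal S$. *)

(* Defs.v *)
From HB Require Import structures.
From mathcomp Require Import all_boot all_order all_algebra.
From mathcomp Require Import reals.
From mathcomp Require Import lra.

Set Implicit Arguments.
Unset Strict Implicit.
Unset Printing Implicit Defensive.

Import Order.TTheory GRing.Theory Num.Theory.

Inductive letter := La | Lb.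

Definition letter_code (l : letter) : bool := if l is La then true else false.
Definition letter_decode (b : bool) : letter := if b then La else Lb.
Lemma letter_codeK : cancel letter_code letter_decode.
Proof. by case. Qed.
HB.instance Definition _ := Choice.copy letter (can_type letter_codeK).

(* Only nonempty words exist in this type, so no unit is needed to evaluate. *)
Inductive word := WLetter of letter | WCons of letter & word.

Fixpoint word_code (w : word) : seq letter :=
  match w with WLetter l => [:: l] | WCons l w' => l :: word_code w' end.
Fixpoint word_decode_from (l : letter) (s : seq letter) : word :=
  if s is l' :: s' then WCons l (word_decode_from l' s') else WLetter l.
Definition word_decode (s : seq letter) : option word :=
  if s is l :: s' then Some (word_decode_from l s') else None.
Lemma word_codeK : pcancel word_code word_decode.
Proof.
elim=> [l|l w IHw] //=; case: w IHw => [l'|l' w'] //= IHw.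
by case: IHw => ->.
Qed.
HB.instance Definition _ := Choice.copy word (pcan_type word_codeK).

Fixpoint word_cat (w1 w2 : word) : word :=
  match w1 with
  | WLetter l => WCons l w2
  | WCons l w => WCons l (word_cat w w2)
  end.
Lemma word_catA : associative word_cat.
Proof. by elim=> [l|l w IHw] w2 w3 //=; rewrite IHw. Qed.
HB.instance Definition _ := isSemigroup.Build word word_catA.

Fixpoint word_eval (S : semigroupType) (w : word) (s t : S) : S :=
  let letter_eval l := if l is La then s else t in
  match w with
  | WLetter l => letter_eval l
  | WCons l w' => (letter_eval l * word_eval w' s t)%g
  end.

Definition word_subst (w s t : word) : word := word_eval w s t.

Definition semigroup_identity (u v : word) : Prop := u <> v.

(* Identities are nontrivial by definition, hence the first conjunct. *)
Definition satisfies (S : semigroupType) (u v : word) : Prop :=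
  semigroup_identity u v /\ forall s t : S, word_eval u s t = word_eval v s t.

Local Open Scope ring_scope.

Definition mxmonoid (n : nat) (S : pzSemiRingType) : Type := 'M[S]_n.
HB.instance Definition _ n (S : pzSemiRingType) :=
  Choice.copy (mxmonoid n S) 'M[S]_n.
HB.instance Definition _ n (S : pzSemiRingType) :=
  isMonoid.Build (mxmonoid n S)
    (@mulmxA S n n n n) (@mul1mx S n n) (@mulmx1 S n n).

Inductive trop (R : realType) := TNInf | TFin of R.
Arguments TNInf {R}.

Section Trop.
Variable R : realType.
Implicit Types x y z : trop R.

Definition trop_code x : option R := if x is TFin a then Some a else None.
Definition trop_decode (o : option R) : trop R :=
  if o is Some a then TFin a else TNInf.
Lemma trop_codeK : cancel trop_code trop_decode.
Proof. by case. Qed.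
HB.instance Definition _ := Choice.copy (trop R) (can_type trop_codeK).

Definition trop_le x y : bool :=
  match x, y with
  | TNInf, _ => true
  | TFin _, TNInf => false
  | TFin a, TFin b => a <= b
  end.
Lemma trop_le_refl : reflexive trop_le.
Proof. by case=> /=. Qed.
Lemma trop_le_anti : antisymmetric trop_le.
Proof. by case=> [|a] [|b] //= /le_anti ->. Qed.
Lemma trop_le_trans : transitive trop_le.
Proof. by case=> [|a] [|b] [|c] //=; apply: le_trans. Qed.
Lemma trop_le_total : total trop_le.
Proof. by case=> [|a] [|b] //=; apply: le_total. Qed.
HB.instance Definition _ := Order.Le_isPOrder.Build ring_display (trop R)
  trop_le_refl trop_le_anti trop_le_trans.
HB.instance Definition _ :=
  Order.POrder_isTotal.Build ring_display (trop R) trop_le_total.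

Definition trop_add x y : trop R := Order.max x y.
Definition trop_mul x y : trop R :=
  match x, y with
  | TFin a, TFin b => TFin (a + b)
  | _, _ => TNInf
  end.

Lemma trop_addA : associative trop_add. Proof. exact: maxA. Qed.
Lemma trop_addC : commutative trop_add. Proof. exact: maxC. Qed.
Lemma trop_add0 : left_id TNInf trop_add.
Proof. by move=> x; apply: max_r. Qed.
Lemma trop_mulA : associative trop_mul.
Proof. by case=> [|a] [|b] [|c] //=; rewrite addrA. Qed.
Lemma trop_mulC : commutative trop_mul.
Proof. by case=> [|a] [|b] //=; rewrite addrC. Qed.
Lemma trop_mul1 : left_id (TFin 0) trop_mul.
Proof. by case=> [|a] //=; rewrite add0r. Qed.
Lemma trop_mul0 : left_zero TNInf trop_mul.
Proof. by []. Qed.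
Lemma trop_leE x y : (x <= y) = trop_le x y. Proof. by []. Qed.
Lemma trop_mulDl : left_distributive trop_mul trop_add.
Proof.
move=> x y z; rewrite /trop_add !maxElt !ltNge !trop_leE.
case: x y z => [|a] [|b] [|c] //=.
  by case: ifP.
by rewrite lerD2r; case: ifP.
Qed.
Lemma trop_1neq0 : TFin 0 != TNInf :> trop R. Proof. by []. Qed.

HB.instance Definition _ :=
  GRing.isNmodule.Build (trop R) trop_addA trop_addC trop_add0.
HB.instance Definition _ := GRing.Nmodule_isComNzSemiRing.Build (trop R)
  trop_mulA trop_mulC trop_mul1 trop_mulDl trop_mul0 trop_1neq0.
End Trop.

(* [STan a] is the real [a] and [SGhost a] its copy a^nu. *)
Inductive strop (R : realType) := SNInf | STan of R | SGhost of R.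
Arguments SNInf {R}.

Section Strop.
Variable R : realType.
Implicit Types x y z : strop R.

Definition strop_code x : option (R + R) :=
  match x with
  | SNInf => None | STan a => Some (inl a) | SGhost a => Some (inr a)
  end.
Definition strop_decode (o : option (R + R)) : strop R :=
  match o with
  | None => SNInf | Some (inl a) => STan a | Some (inr a) => SGhost a
  end.
Lemma strop_codeK : cancel strop_code strop_decode.
Proof. by case. Qed.
HB.instance Definition _ := Choice.copy (strop R) (can_type strop_codeK).

Definition strop_nu x : strop R :=
  match x with SNInf => SNInf | STan a | SGhost a => SGhost a end.

(* -oo < a < a^nu < b < b^nu whenever a < b *)
Definition strop_le x y : bool :=
  match x, y with
  | SNInf, _ => true
  | _, SNInf => false
  | SGhost a, STan b => a < b
  | STan a, STan b | STan a, SGhost b | SGhost a, SGhost b => a <= b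
  end.
Lemma strop_le_refl : reflexive strop_le.
Proof. by case=> /=. Qed.
Lemma strop_le_anti : antisymmetric strop_le.
Proof.
case=> [|a|a] [|b|b] //=; do ?by move=> /le_anti ->.
- by move=> /andP[ab]; rewrite ltNge ab.
- by move=> /andP[ab]; rewrite leNgt ab.
Qed.
Lemma strop_le_trans : transitive strop_le.
Proof. by case=> [|a|a] [|b|b] [|c|c] //=; lra. Qed.
Lemma strop_le_total : total strop_le.
Proof. by case=> [|a|a] [|b|b] //=; lra. Qed.
HB.instance Definition _ := Order.Le_isPOrder.Build ring_display (strop R)
  strop_le_refl strop_le_anti strop_le_trans.
HB.instance Definition _ :=
  Order.POrder_isTotal.Build ring_display (strop R) strop_le_total.

Definition strop_add x y : strop R :=
  if strop_nu x == strop_nu y then strop_nu x else Order.max x y.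
Definition strop_mul x y : strop R :=
  match x, y with
  | STan a, STan b => STan (a + b)
  | _, _ =>
    match strop_nu x, strop_nu y with
    | SGhost a, SGhost b => SGhost (a + b)
    | _, _ => SNInf
    end
  end.

Lemma strop_leE x y : (x <= y) = strop_le x y. Proof. by []. Qed.

Lemma strop_addE x y : strop_add x y =
  match x, y with
  | SNInf, _ => y
  | _, SNInf => x
  | STan a, STan b | STan a, SGhost b | SGhost a, STan b | SGhost a, SGhost b =>
    if a < b then y else if b < a then x else SGhost a
  end.
Proof.
have eqG (a b : R) : (SGhost a == SGhost b) = (a == b).
  by apply/eqP/eqP => [[]|->].
rewrite /strop_add maxElt ltNge strop_leE.
by case: x y => [|a|a] [|b|b] //=; rewrite eqG; case: ltgtP.
Qed.

Lemma strop_addA : associative strop_add.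
Proof.
move=> x y z; rewrite !strop_addE.
case: x y z => [|a|a] [|b|b] [|c|c] //=;
do ![case: ltgtP => //= ?; subst => //=]; exfalso; lra.
Qed.
Lemma strop_addC : commutative strop_add.
Proof.
by move=> x y; rewrite !strop_addE; case: x y => [|a|a] [|b|b] //=;
  case: ltgtP => // ->.
Qed.
Lemma strop_add0 : left_id SNInf strop_add.
Proof. by move=> x; rewrite strop_addE. Qed.
Lemma strop_mulA : associative strop_mul.
Proof. by case=> [|a|a] [|b|b] [|c|c] //=; rewrite addrA. Qed.
Lemma strop_mulC : commutative strop_mul.
Proof. by case=> [|a|a] [|b|b] //=; rewrite addrC. Qed.
Lemma strop_mul1 : left_id (STan 0) strop_mul.
Proof. by case=> [|a|a] //=; rewrite add0r. Qed.
Lemma strop_mul0 : left_zero SNInf strop_mul.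
Proof. by case. Qed.
Lemma strop_mulDl : left_distributive strop_mul strop_add.
Proof.
move=> x y z; rewrite !strop_addE.
case: x y z => [|a|a] [|b|b] [|c|c] //=;
by rewrite ?ltrD2r; case: ltgtP.
Qed.
Lemma strop_1neq0 : STan 0 != SNInf :> strop R. Proof. by []. Qed.

HB.instance Definition _ :=
  GRing.isNmodule.Build (strop R) strop_addA strop_addC strop_add0.
HB.instance Definition _ := GRing.Nmodule_isComNzSemiRing.Build (strop R)
  strop_mulA strop_mulC strop_mul1 strop_mulDl strop_mul0 strop_1neq0.
End Strop.

(* Main.v *)
Require Import Defs.
From HB Require Import structures.
From mathcomp Require Import all_boot all_order all_algebra.
From mathcomp Require Import reals.
From mathcomp Require Import lra.

Set Implicit Arguments.
Unset Strict Implicit.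
Unset Printing Implicit Defensive.

Import Order.TTheory GRing.Theory Num.Theory.

(** Forgetting whether an entry is tangible or ghost is a semiring morphism
    from ST to T, so A = u'[[s,t]] and B = v'[[s,t]] have the same image in
    M_n(T), and it remains to see that u[[A,B]] = v[[A,B]] whenever A and B
    differ only in the ghostness of their entries
    ([word_eval_eq_of_forget]).

    An entry of w[[A,B]] is a maximum over the paths of length |w| between two
    indices. The weights of these paths do not depend on w, because A and B
    have the same weights, and |u| = |v|, as scalar matrices show
    ([word_size_eq_of_satisfies]). If the maximum is reached twice, the entry
    is ghost for both words. If it is reached by one path only, the entry is
    ghost exactly when this path uses a ghost entry. To see this in a tropical
    matrix, lower each ghost entry by a small t > 0: the optimal path does not
    change, and its weight drops by k t, where k is the number of ghost entries
    on it. Since the lowered matrices satisfy the identity [u = v] for every t,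
    the number k is the same for u and v, hence so is ghostness.

    Paths are never mentioned in the proof. Whether the optimal path is unique
    is read off from the evaluation at the matrix C obtained from A, or from B,
    by making all entries tangible: an entry of C ^ |w| is tangible iff it is
    reached by a single path. The relation [shadow] couples an entry of
    C ^ |w|, the same entry of w[[A,B]], and its lowered tropical version as a
    function of t; it is preserved by sums and products ([shadowD],
    [shadowM]), hence by matrix products, and it determines the entry of
    w[[A,B]] from the other two ([shadow_inj]).

    The resulting identity is nontrivial because u' and v' are distinct words
    of the same length, and substituting such words is injective
    ([word_subst_inj]). *)

(** * Words, evaluation and substitution *)

Definition word_size (w : word) : nat := size (word_code w).

Lemma word_eval_morph (S T : semigroupType) (f : S -> T) (w : word) (s t : S) :
  {morph f : x y / (x * y)%g} -> f (word_eval w s t) = word_eval w (f s) (f t).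
Proof.
by move=> fM; elim: w => [[]|[] w IHw] //=; rewrite fM IHw.
Qed.

Lemma word_eval_cat (S : semigroupType) (s t : S) :
  {morph (fun w => word_eval w s t) : w1 w2 / (w1 * w2)%g}.
Proof. by move=> w1 w2; elim: w1 => [[]|[] w IHw] //=; rewrite IHw mulgA. Qed.

Lemma word_eval_subst (S : semigroupType) (w p q : word) (s t : S) :
  word_eval (word_subst w p q) s t =
  word_eval w (word_eval p s t) (word_eval q s t).
Proof. exact: (word_eval_morph _ _ _ (@word_eval_cat S s t)). Qed.

Lemma word_eval_diag (S : monoidType) (w : word) (s : S) :
  word_eval w s s = (s ^+ word_size w)%g.
Proof.
rewrite /word_size; elim: w => [[]|[] w IHw] /=; rewrite ?expg1 // IHw;
  by rewrite -expgS.
Qed.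

Lemma word_code_cat (w1 w2 : word) :
  word_code (w1 * w2)%g = word_code w1 ++ word_code w2.
Proof. by elim: w1 => [l|l w IHw] //=; rewrite IHw. Qed.

Lemma word_code_subst (w p q : word) :
  word_code (word_subst w p q) =
  flatten
    [seq (if l is La then word_code p else word_code q) | l <- word_code w].
Proof.
elim: w => [[]|[] w IHw] /=; rewrite ?cats0 //;
  by rewrite -IHw -word_code_cat.
Qed.

(** Code words of a common positive length can be cut off one at a time. *)
Lemma flatten_map_inj (T U : eqType) (f : T -> seq U) (m : nat) :
  injective f -> (0 < m)%N -> (forall x, size (f x) = m) ->
  injective (fun s => flatten (map f s)).
Proof.
move=> f_inj m_gt0 f_size; elim=> [|x s IHs] [|y r] //=.
- by move/(congr1 size); rewrite size_cat f_size /=; case: (m) m_gt0.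
- by move/(congr1 size); rewrite size_cat f_size /=; case: (m) m_gt0.
move/eqP; rewrite eqseq_cat ?f_size // => /andP[/eqP/f_inj -> /eqP/IHs ->].
by [].
Qed.

Lemma word_subst_inj (p q : word) :
  p <> q -> word_size p = word_size q -> injective (fun w => word_subst w p q).
Proof.
move=> neq_pq eq_size w1 w2 /(congr1 word_code); rewrite !word_code_subst.
move=> /flatten_map_inj H; apply: (pcan_inj word_codeK).
apply: (H (word_size p)) => //.
- by case=> [] [] // /(pcan_inj word_codeK) // /esym.
- by case: (p).
- by case.
Qed.

Local Open Scope ring_scope.

(** * The tropical semiring *)

Section Tropical.
Variable R : realType.
Implicit Types (a b e t : R) (x y z : strop R) (g h : R -> trop R).

Lemma tropD a b : TFin a + TFin b = TFin (Num.max a b) :> trop R.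
Proof.
rewrite /GRing.add /= /trop_add !maxElt !ltNge trop_leE /=.
by case: ifP.
Qed.

Lemma trop_addr_r (c d : trop R) : c <= d -> c + d = d.
Proof. exact: max_r. Qed.

Lemma trop_add_le (c d k : trop R) : c <= k -> d <= k -> c + d <= k.
Proof. by move=> ck dk; rewrite [c + d]/(Order.max c d) ge_max ck. Qed.

(** At the scalar matrix of the real number 1, a word evaluates to the scalar
    matrix of its length; [n] must be positive for this to show in an entry. *)
Lemma word_size_eq_of_satisfies n (u v : word) : (1 <= n)%N ->
  satisfies (mxmonoid n (trop R)) u v -> word_size u = word_size v.
Proof.
case: n => // n _ [_ /(_ (TFin 1)%:M (TFin 1)%:M)].
rewrite !word_eval_diag.
have powE m :
    (((TFin 1)%:M : mxmonoid n.+1 (trop R)) ^+ m)%g = (TFin (m%:R : R))%:M.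
  elim: m => [|m IHm]; first by [].
  rewrite expgS IHm; apply: (etrans (esym (scalar_mxM _ _ _))).
  by congr (_ %:M); rewrite -[m.+1]add1n natrD.
rewrite !powE => /matrixP /(_ ord0 ord0).
by rewrite !mxE !eqxx !mulr1n => -[] /eqP; rewrite eqr_nat => /eqP.
Qed.

(** * Tropical images of supertropical elements *)

Definition debit t x : trop R :=
  match x with SNInf => TNInf | STan a => TFin a | SGhost a => TFin (a - t) end.

Definition forget x : trop R :=
  match x with SNInf => TNInf | STan a | SGhost a => TFin a end.

Definition tangible_lift (c : trop R) : strop R :=
  if c is TFin a then STan a else SNInf.

Lemma forget_nmod_morphism : nmod_morphism forget.
Proof.
split=> // x y; rewrite [x + y]strop_addE.
case: x y => [|a|a] [|b|b] //=; rewrite ?tropD ?maxElt;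
  rewrite ?addr0 ?add0r //; by case: ltgtP => //= ->.
Qed.

Lemma forget_monoid_morphism : GRing.monoid_morphism forget.
Proof. by split=> // -[|a|a] [|b|b]. Qed.

HB.instance Definition _ := GRing.isNmodMorphism.Build (strop R) (trop R) forget
  forget_nmod_morphism.
HB.instance Definition _ := GRing.isMonoidMorphism.Build (strop R) (trop R)
  forget forget_monoid_morphism.

(** A strictly larger summand keeps its own ghostness: ghosts arise in a sum
    only from ties. *)
Lemma strop_addr_r x y : forget x < forget y -> x + y = y.
Proof.
rewrite ltNge trop_leE [x + y]strop_addE.
by case: x y => [|a|a] [|b|b] //=; case: ltgtP.
Qed.

(** * Properties that hold for all small positive reals *)

Definition near0 (P : R -> Prop) : Prop :=
  exists2 e, 0 < e & forall t, 0 < t < e -> P t.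

Lemma near0T (P : R -> Prop) : (forall t, 0 < t -> P t) -> near0 P.
Proof. by move=> HP; exists 1 => // t /andP[/HP]. Qed.

Lemma near0_imply2 (P Q S : R -> Prop) :
  (forall t, 0 < t -> P t -> Q t -> S t) -> near0 P -> near0 Q -> near0 S.
Proof.
move=> PQS [e e_gt0 eP] [d d_gt0 dQ]; exists (Num.min e d).
  by rewrite lt_min e_gt0.
move=> t /andP[t_gt0]; rewrite lt_min => /andP[te td].
by apply: PQS => //; [apply: eP|apply: dQ]; rewrite t_gt0.
Qed.

Lemma near0_imply (P Q : R -> Prop) :
  (forall t, 0 < t -> P t -> Q t) -> near0 P -> near0 Q.
Proof.
move=> PQ [e e_gt0 eP]; exists e => // t te.
by apply: PQ; [case/andP: te|apply: eP].
Qed.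

Lemma near0_ex (P : R -> Prop) : near0 P -> exists2 t, 0 < t & P t.
Proof. by move=> [e e_gt0 eP]; exists (e / 2); [|apply: eP]; lra. Qed.

Lemma near0_lt a b (k : nat) : a < b -> near0 (fun t => a < b - t * k%:R).
Proof.
move=> ab; exists ((b - a) / k.+1%:R); first by rewrite divr_gt0 // subr_gt0.
move=> t /andP[t_gt0]; rewrite ltr_pdivlMr ?ltr0Sn // -natr1 mulrDr mulr1.
lra.
Qed.

(** * Following the ghost entries along optimal paths *)

(** Think of [y], [x] and [g] as one entry of the evaluation with all entries
    made tangible, of the actual evaluation, and of the evaluation where every
    ghost has been lowered by [t]. When [y] is tangible there is a single
    optimal path, and [k] counts the ghosts on it. When [y] is ghost several
    paths compete; the lowered value is then useless and only has to stay
    below [a], so that it is still dominated by any larger summand. *)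
Definition shadow y x g : Prop :=
  match y with
  | SNInf => x = SNInf /\ near0 (fun t => g t = TNInf)
  | STan a => exists2 k : nat, x = (if k == 0%N then STan a else SGhost a)
                & near0 (fun t => g t = TFin (a - t * k%:R))
  | SGhost a => x = SGhost a /\ near0 (fun t => g t <= TFin a)
  end.

Lemma shadow_ext y x g h : g =1 h -> shadow y x g -> shadow y x h.
Proof.
move=> gh; case: y => [|a|a] /=.
- by case=> -> gE; split=> //; apply: near0_imply gE => t _; rewrite gh.
- by case=> k -> gE; exists k => //; apply: near0_imply gE => t _; rewrite gh.
- by case=> -> gE; split=> //; apply: near0_imply gE => t _; rewrite gh.
Qed.

Lemma shadow_forget y x g : shadow y x g -> forget x = forget y.
Proof. by case: y => [|a|a] /= [] // => [->|k ->|->] //; case: ifP. Qed.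

Lemma shadow_le y x g : shadow y x g -> near0 (fun t => g t <= forget y).
Proof.
case: y => [|a|a] /= [] //.
  by move=> _; apply: near0_imply => t _ ->.
move=> k _; apply: near0_imply => t t_gt0 ->; rewrite trop_leE /=.
by rewrite gerBl mulr_ge0 // ltW.
Qed.

(** A strictly smaller summand is still smaller after lowering the ghosts of
    both by a small amount, so it does not disturb the relation. *)
Lemma shadow_add_small y x g h f (c : trop R) : shadow y x g ->
  near0 (fun t => h t <= c) -> c < forget y -> (forall t, f t = h t + g t) ->
  shadow y x f.
Proof.
move=> yxg hc; rewrite ltNge trop_leE => cy fE.
case: y yxg cy => [|a|a] /=; first by case: (c).
- case=> k -> gE ca; exists k => //.
  have cg : near0 (fun t => c <= g t).
    case: c ca {hc} => [|d] /= da; first exact: near0T.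
    rewrite -ltNge in da.
    by apply: (near0_imply2 _ gE (near0_lt k da)) => t _ -> /ltW.
  have hg : near0 (fun t => h t <= g t).
    by apply: (near0_imply2 _ hc cg) => t _; apply: le_trans.
  by apply: (near0_imply2 _ hg gE) => t _ le_hg <-; rewrite fE trop_addr_r.
- case=> -> ga ca; split=> //; apply: (near0_imply2 _ hc ga) => t _ h_le g_le.
  rewrite fE trop_add_le // (le_trans h_le) //; case: (c) ca => // d /=.
  by rewrite -ltNge => /ltW.
Qed.

(** With distinct real parts the smaller summand disappears. With equal ones
    the tie makes both supertropical sums ghost, and only the upper bound
    matters. *)
Lemma shadowD y1 x1 g1 y2 x2 g2 : shadow y1 x1 g1 -> shadow y2 x2 g2 ->
  shadow (y1 + y2) (x1 + x2) (fun t => g1 t + g2 t).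
Proof.
move=> H1 H2; have [F1 F2] := (shadow_forget H1, shadow_forget H2).
have [L1 L2] := (shadow_le H1, shadow_le H2).
case: (ltgtP (forget y1) (forget y2)) => [lt12|lt21|eq12].
- rewrite !strop_addr_r ?F1 ?F2 //.
  exact: (shadow_add_small H2 L1 lt12).
- rewrite [y1 + _]addrC [x1 + _]addrC !strop_addr_r ?F1 ?F2 //.
  by apply: (shadow_add_small H1 L2 lt21) => t; rewrite addrC.
have {}L : near0 (fun t => g1 t + g2 t <= forget y1).
  apply: (near0_imply2 _ L1 L2) => t _ le1 le2.
  by rewrite trop_add_le // eq12.
have ghostD x y a : forget x = TFin a -> forget y = TFin a -> x + y = SGhost a.
  by rewrite [x + y]strop_addE; case: x y => [|b|b] [|c|c] //= [->] [->];
     rewrite ltxx.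
case E: (forget y1) => [|a]; rewrite ?E in eq12 F1 L; last first.
  by rewrite (ghostD y1 y2 a) // (ghostD x1 x2 a) // F2.
case: y1 y2 x1 x2 E {H1 H2 L1 L2} eq12 F1 F2 => [|?|?] [|?|?] [|?|?] [|?|?] //.
move=> _ _ _ _; split=> //; apply: near0_imply L => t _; rewrite trop_leE.
by case: (g1 t + g2 t).
Qed.

(** Concatenating optimal paths adds up the numbers of ghosts on them. *)
Lemma shadowM y1 x1 g1 y2 x2 g2 : shadow y1 x1 g1 -> shadow y2 x2 g2 ->
  shadow (y1 * y2) (x1 * x2) (fun t => g1 t * g2 t).
Proof.
move=> H1 H2; have [L1 L2] := (shadow_le H1, shadow_le H2).
have [F1 F2] := (shadow_forget H1, shadow_forget H2).
have L a b : forget y1 = TFin a -> forget y2 = TFin b ->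
    near0 (fun t => g1 t * g2 t <= TFin (a + b)).
  move=> E1 E2; rewrite E1 in L1; rewrite E2 in L2.
  apply: (near0_imply2 _ L1 L2) => t _; rewrite !trop_leE.
  by case: (g1 t) (g2 t) => [|c] [|d] //=; apply: lerD.
case: y1 H1 L F1 {L1 L2} => [|a|a].
- case=> -> g1E _ _; rewrite mul0r; split=> //.
  by apply: near0_imply g1E => t _ ->.
- case: y2 H2 F2 => [|b|b].
  + case=> -> g2E _ _ _ _; rewrite !mulr0; split=> //.
    by apply: near0_imply g2E => t _ ->; rewrite [LHS]mulr0.
  + case=> l -> g2E _ [k -> g1E] _ _; exists (k + l)%N.
      by rewrite addn_eq0; case: (k == 0)%N (l == 0)%N => [] [].
    apply: (near0_imply2 _ g1E g2E) => t _ -> ->; congr TFin.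
    by rewrite natrD; lra.
  + case=> -> _ _ _ L F1; split; last exact: L.
    by case: x1 F1 => [|c|c] //= [->].
- case: y2 H2 F2 => [|b|b].
  + case=> -> g2E _ _ _ _; rewrite !mulr0; split=> //.
    by apply: near0_imply g2E => t _ ->; rewrite [LHS]mulr0.
  + move=> _ F2 [-> _] L _; split; last exact: L.
    by case: x2 F2 => [|c|c] //= [->].
  + by case=> -> _ _ [-> _] L _; split; last exact: L.
Qed.

Lemma shadow_sum (I : Type) (r : seq I) (Y X : I -> strop R)
    (G : I -> R -> trop R) :
  (forall i, shadow (Y i) (X i) (G i)) ->
  shadow (\sum_(i <- r) Y i) (\sum_(i <- r) X i)
    (fun t => \sum_(i <- r) G i t).
Proof.
move=> YXG; elim: r => [|i r IHr].
  by rewrite !big_nil; split=> //; apply: near0T => t _; rewrite big_nil.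
have := shadowD (YXG i) IHr; rewrite !big_cons; apply: shadow_ext => t.
by rewrite big_cons.
Qed.

Lemma shadow_entry x : shadow (tangible_lift (forget x)) x (debit^~ x).
Proof.
case: x => [|a|a] /=; first by split=> //; apply: near0T.
  by exists 0%N => //; apply: near0T => t _; rewrite mulr0 subr0.
by exists 1%N => //; apply: near0T => t _; rewrite mulr1.
Qed.

(** For tangible [y] the slope of [g] near 0 is minus the number of ghosts on
    the optimal path, and [x] is tangible iff this number is zero. *)
Lemma shadow_inj y x1 x2 g1 g2 :
  shadow y x1 g1 -> shadow y x2 g2 -> g1 =1 g2 -> x1 = x2.
Proof.
case: y => [|a|a] /=; try by move=> [-> _] [-> _].
move=> [k -> g1E] [l -> g2E] g12.
suff -> : k = l by [].
have : near0 (fun t => (k%:R : R) = l%:R).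
  apply: (near0_imply2 _ g1E g2E) => t t_gt0; rewrite g12 => -> [] /addrI.
  by move/oppr_inj/(mulfI (lt0r_neq0 t_gt0)).
by case/near0_ex => _ _ /eqP; rewrite eqr_nat => /eqP.
Qed.

(** * Matrices *)

Section Matrices.
Variable n : nat.

Lemma word_eval_shadow (w : word) (A B : mxmonoid n (strop R))
    (C : mxmonoid n (strop R)) :
  C = map_mx (tangible_lift \o forget) A ->
  C = map_mx (tangible_lift \o forget) B ->
  forall i j, shadow ((word_eval w C C : 'M_n) i j)
    ((word_eval w A B : 'M_n) i j)
    (fun t => (word_eval w (map_mx (debit t) A : mxmonoid n (trop R))
                 (map_mx (debit t) B) : 'M_n) i j).
Proof.
move=> CA CB.
have letterP l i j : shadow ((C : 'M_n) i j)
    (((if l is La then A else B) : 'M_n) i j)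
    (fun t => ((if l is La then map_mx (debit t) A else map_mx (debit t) B)
               : 'M_n) i j).
  case: l; [rewrite CA|rewrite CB]; rewrite mxE;
    by apply: shadow_ext (shadow_entry _) => t; rewrite mxE.
elim: w => [l|l w IHw] i j; first by case: l (letterP l i j).
have -> : word_eval (WCons l w) C C = (C : 'M_n) *m (word_eval w C C : 'M_n).
  by case: l.
rewrite [word_eval _ A B]/= !mxE.
apply: shadow_ext (shadow_sum (index_enum _)
  (fun k => shadowM (letterP l i k) (IHw k j))) => t.
by rewrite /= mxE; case: l.
Qed.

(** The heart of the argument: a tropical identity passes to pairs of
    supertropical matrices that differ only in ghostness. Evaluated at the
    common tangible lift, both words give the same power of one matrix, so the
    first components of the two [shadow] triples agree; the tropical identity
    makes the third components agree. *)
Lemma word_eval_eq_of_forget (u v : word) (A B : mxmonoid n (strop R)) :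
  word_size u = word_size v ->
  (forall s t : mxmonoid n (trop R), word_eval u s t = word_eval v s t) ->
  map_mx forget A = map_mx forget B -> word_eval u A B = word_eval v A B.
Proof.
move=> eq_size uv eqAB; apply/matrixP => i j.
have eqC : map_mx (tangible_lift \o forget) A
         = map_mx (tangible_lift \o forget) B.
  by rewrite !map_mx_comp eqAB.
have Hu := word_eval_shadow u (erefl _) eqC i j.
have Hv := word_eval_shadow v (erefl _) eqC i j.
rewrite !word_eval_diag eq_size in Hu Hv.
by apply: (shadow_inj Hu Hv) => t; rewrite uv.
Qed.

Lemma forget_word_eval (w : word) (s t : mxmonoid n (strop R)) :
  map_mx forget (word_eval w s t) =
  word_eval w (map_mx forget s : mxmonoid n (trop R)) (map_mx forget t).
Proof.
apply: (@word_eval_morph (mxmonoid n (strop R)) (mxmonoid n (trop R))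
  (map_mx forget)) => A B.
exact: map_mxM.
Qed.
End Matrices.
End Tropical.

Theorem theorem3p4 (R : realType) (n : nat) (hn : (1 <= n)%N)
  (u v u' v' : word)
  (huv : satisfies (mxmonoid n (trop R)) u v)
  (huv' : satisfies (mxmonoid n (trop R)) u' v') :
  satisfies (mxmonoid n (strop R)) (word_subst u u' v') (word_subst v u' v').
Proof.
have eq_size := word_size_eq_of_satisfies hn huv.
have eq_size' := word_size_eq_of_satisfies hn huv'.
case: huv huv' => neq_uv uv [neq_uv' uv']; split.
  by move/(word_subst_inj neq_uv' eq_size').
move=> s t; rewrite !word_eval_subst.
apply: word_eval_eq_of_forget => //.
by rewrite !forget_word_eval uv'.
Qed.
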